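(* Let $\mathcal{B},\mathcal{B}'$ be bicategories with shadows, let $F\colon\mathcal{B}\to\mathcal{B}'$ be a lax functor compatible with shadows, and let $(X,Y)$ be a dual pair in $\mathcal{B}$ with $X\in\mathcal{B}(B,A)$, $Y\in\mathcal{B}(A,B)$, such that $\phi_{X,Y}\colon F(X)\odot F(Y)\to F(X\odot Y)$ and $\phi_B\colon U'_{F(B)}\to F(U_B)$ are isomorphisms. Let $Q\in\mathcal{B}(A,A)$, $P\in\mathcal{B}(B,B)$, let $f\colon Q\odot X\to X\odot P$ be a 2-cell, suppose $\phi_{X,P}$ is an isomorphism, and let $\hat f$ be the composite $$FQ\odot FX\xrightarrow{\phi_{Q,X}}F(Q\odot X)\xrightarrow{F(f)}F(X\odot P)\xrightarrow{\phi_{X,P}^{-1}}FX\odot FP.$$ Then $$\psi_B\circ\mathrm{tr}(\hat f)=F(\mathrm{tr}(f))\circ\psi_A\colon\langle\langle FQ\rangle\rangle\to F\langle\langle P\rangle\rangle .$$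
   Context: A bicategory $\mathcal{B}$ has composition $\odot\colon\mathcal{B}(B,C)\times\mathcal{B}(A,B)\to\mathcal{B}(A,C)$ and units $U_A\in\mathcal{B}(A,A)$. Dual pair: $(X,Y)$ with $X\in\mathcal{B}(B,A)$, $Y\in\mathcal{B}(A,B)$ is a dual pair if there are 2-cells $\eta\colon U_A\to X\odot Y$ (coevaluation) and $\epsilon\colon Y\odot X\to U_B$ (evaluation) such that, modulo associativity and unit isomorphisms, $(\mathrm{id}_X\odot\epsilon)(\eta\odot\mathrm{id}_X)=\mathrm{id}_X$ and $(\epsilon\odot\mathrm{id}_Y)(\mathrm{id}_Y\odot\eta)=\mathrm{id}_Y$. Under the hypotheses on $\phi_{X,Y}$ and $\phi_B$, $(FX,FY)$ is a dual pair with coevaluation $\phi_{X,Y}^{-1}F(\eta)\phi_A$ and evaluation $\phi_B^{-1}F(\epsilon)\phi_{Y,X}$. Shadows: $\mathcal{B}$ has shadows if there are a 0-cell $I$, functors $\langle\langle-\rangle\rangle\colon\mathcal{B}(A,A)\to\mathcal{B}(I,I)$ for all 0-cells $A$, with $\langle\langle X\rangle\rangle\cong X$ for $X\in\mathcal{B}(I,I)$, and natural isomorphisms $\theta\colon\langle\langle X\odot Y\rangle\rangle\cong\langle\langle Y\odot X\rangle\rangle$ for $X\in\mathcal{B}(B,A)$, $Y\in\mathcal{B}(A,B)$, such that (suppressing associativity and units) the composite $\langle\langle X\odot Y\odot Z\rangle\rangle\xrightarrow{\theta}\langle\langle Y\odot Z\odot X\rangle\rangle\xrightarrow{\theta}\langle\langle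 Z\odot X\odot Y\rangle\rangle$ equals $\theta\colon\langle\langle(X\odot Y)\odot Z\rangle\rangle\to\langle\langle Z\odot(X\odot Y)\rangle\rangle$, and $\theta\colon\langle\langle Z\odot U_A\rangle\rangle\to\langle\langle U_A\odot Z\rangle\rangle$ and $\theta\colon\langle\langle U_A\odot Z\rangle\rangle\to\langle\langle Z\odot U_A\rangle\rangle$ are compatible with the unit isomorphisms to $\langle\langle Z\rangle\rangle$. Trace: for $(X,Y)$ a dual pair and $f\colon Q\odot X\to X\odot P$, $\mathrm{tr}(f)$ is $$\langle\langle Q\rangle\rangle\cong\langle\langle Q\odot U_A\rangle\rangle\xrightarrow{\mathrm{id}\odot\eta}\langle\langle Q\odot X\odot Y\rangle\rangle\xrightarrow{f\odot\mathrm{id}}\langle\langle X\odot P\odot Y\rangle\rangle\cong\langle\langle Y\odot X\odot P\rangle\rangle\xrightarrow{\epsilon\odot\mathrm{id}}\langle\langle U_B\odot P\rangle\rangle\cong\langle\langle P\rangle\rangle,$$ the middle isomorphism being $\theta$. Lax functor: a function on 0-cells, functors $F\colon\mathcal{B}(A,B)\to\mathcal{B}'(FA,FB)$, and natural transformations $\phi_{X,Y}\colon FX\odot FY\to F(X\odot Y)$, $\phi_A\colon U'_{FA}\to F(U_A)$ satisfying the usual coherence conditions. $F$ is compatible with shadows if (with $F$ taking the chosen 0-cell of $\mathcal{B}$ to that of $\mathcal{B}'$) for each 0-cell $A$ there is a natural transformation $\psi_A\colon\langle\langle F(-)\rangle\rangle\to F\langle\langle-\rangle\rangle$ with $\psi_B\circ\langle\langle\phi_{Y,X}\rangle\rangle\circ\theta=F(\theta)\circ\psi_A\circ\langle\langle\phi_{X,Y}\rangle\rangle$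 for all $X\in\mathcal{B}(B,A)$, $Y\in\mathcal{B}(A,B)$. *)

(* Defs.v *)
Set Implicit Arguments.
Unset Strict Implicit.

Declare Scope bicat_scope.
Delimit Scope bicat_scope with bicat.
Open Scope bicat_scope.

Reserved Notation "g ∘ f" (at level 40, left associativity).
Reserved Notation "X ⊙ Y" (at level 35, right associativity).
Reserved Notation "f ⊙₂ g" (at level 35, right associativity).

Record Category := {
  obj :> Type;
  hom : obj -> obj -> Type;
  idm : forall x, hom x x;
  comp : forall x y z, hom y z -> hom x y -> hom x z;
  comp_idl : forall x y (f : hom x y), comp (idm y) f = f;
  comp_idr : forall x y (f : hom x y), comp f (idm x) = f;
  comp_assoc : forall x y z t (h : hom z t) (g : hom y z) (f : hom x y),
    comp h (comp g f) = comp (comp h g) f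
}.
Arguments hom {_} _ _.
Arguments idm {_} _.
Arguments comp {_ _ _ _} _ _.
Notation "g ∘ f" := (comp g f) : bicat_scope.

Record IsIso (C : Category) (x y : C) (f : hom x y) := {
  inv : hom y x;
  inv_l : inv ∘ f = idm x;
  inv_r : f ∘ inv = idm y
}.
Arguments IsIso {_ _ _} _.
Arguments inv {_ _ _ _} _.

Record Functor (C D : Category) := {
  fobj :> C -> D;
  fmap : forall x y, hom x y -> hom (fobj x) (fobj y);
  fmap_id : forall x, fmap (idm x) = idm (fobj x);
  fmap_comp : forall x y z (g : hom y z) (f : hom x y),
    fmap (g ∘ f) = fmap g ∘ fmap f
}.
Arguments fmap {_ _} _ {_ _} _.

Definition idF (C : Category) : Functor C C :=
  {| fobj := fun x => x; fmap := fun x y f => f;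
     fmap_id := fun x => eq_refl; fmap_comp := fun x y z g f => eq_refl |}.

Definition compF (C D E : Category) (G : Functor D E) (F : Functor C D) :
  Functor C E.
Proof.
  refine {| fobj := fun x => G (F x);
            fmap := fun x y f => fmap G (fmap F f) |}.
  - intros x; rewrite fmap_id; apply fmap_id.
  - intros x y z g f; rewrite fmap_comp; apply fmap_comp.
Defined.

(* [cell1 A B] is the category B(A,B).  [⊙] is in applicative order.  Its
   functoriality B(B,C) x B(A,B) -> B(A,C) is spelled out by [odot2], [odot2_id]
   and [odot2_comp]. *)
Record Bicategory := {
  cell0 :> Type;
  cell1 : cell0 -> cell0 -> Category;
  unit1 : forall A, cell1 A A;
  odot : forall A B C, cell1 B C -> cell1 A B -> cell1 A C;
  odot2 : forall A B C (X X' : cell1 B C) (Y Y' : cell1 A B),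
    hom X X' -> hom Y Y' -> hom (odot X Y) (odot X' Y');
  odot2_id : forall A B C (X : cell1 B C) (Y : cell1 A B),
    odot2 (idm X) (idm Y) = idm (odot X Y);
  odot2_comp : forall A B C (X X' X'' : cell1 B C) (Y Y' Y'' : cell1 A B)
      (f' : hom X' X'') (f : hom X X') (g' : hom Y' Y'') (g : hom Y Y'),
    odot2 (f' ∘ f) (g' ∘ g) = odot2 f' g' ∘ odot2 f g;

  assoc : forall A B C D (X : cell1 C D) (Y : cell1 B C) (Z : cell1 A B),
    hom (odot (odot X Y) Z) (odot X (odot Y Z));
  assoc_iso : forall A B C D (X : cell1 C D) (Y : cell1 B C) (Z : cell1 A B),
    IsIso (assoc X Y Z);
  assoc_nat : forall A B C D (X X' : cell1 C D) (Y Y' : cell1 B C)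
      (Z Z' : cell1 A B) (f : hom X X') (g : hom Y Y') (h : hom Z Z'),
    assoc X' Y' Z' ∘ odot2 (odot2 f g) h
      = odot2 f (odot2 g h) ∘ assoc X Y Z;

  lunit : forall A B (X : cell1 A B), hom (odot (unit1 B) X) X;
  lunit_iso : forall A B (X : cell1 A B), IsIso (lunit X);
  lunit_nat : forall A B (X X' : cell1 A B) (f : hom X X'),
    lunit X' ∘ odot2 (idm (unit1 B)) f = f ∘ lunit X;

  runit : forall A B (X : cell1 A B), hom (odot X (unit1 A)) X;
  runit_iso : forall A B (X : cell1 A B), IsIso (runit X);
  runit_nat : forall A B (X X' : cell1 A B) (f : hom X X'),
    runit X' ∘ odot2 f (idm (unit1 A)) = f ∘ runit X;

  pentagon : forall A B C D E (X : cell1 D E) (Y : cell1 C D)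
      (Z : cell1 B C) (W : cell1 A B),
    odot2 (idm X) (assoc Y Z W) ∘ assoc X (odot Y Z) W
        ∘ odot2 (assoc X Y Z) (idm W)
      = assoc X Y (odot Z W) ∘ assoc (odot X Y) Z W;
  triangle : forall A B C (X : cell1 B C) (Y : cell1 A B),
    odot2 (idm X) (lunit Y) ∘ assoc X (unit1 B) Y
      = odot2 (runit X) (idm Y)
}.
Arguments cell1 {_} _ _.
Arguments unit1 {_} _.
Arguments odot {_ _ _ _} _ _.
Arguments odot2 {_ _ _ _ _ _ _ _} _ _.
Arguments assoc {_ _ _ _ _} _ _ _.
Arguments assoc_iso {_ _ _ _ _} _ _ _.
Arguments lunit {_ _ _} _.
Arguments lunit_iso {_ _ _} _.
Arguments runit {_ _ _} _.
Arguments runit_iso {_ _ _} _.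
Notation "X ⊙ Y" := (odot X Y) : bicat_scope.
Notation "f ⊙₂ g" := (odot2 f g) : bicat_scope.

Record DualPair (BB : Bicategory) (A B : BB)
    (X : cell1 B A) (Y : cell1 A B) := {
  coev : hom (unit1 A) (X ⊙ Y);
  ev : hom (Y ⊙ X) (unit1 B);
  dual_triangle_l :
    runit X ∘ (idm X ⊙₂ ev) ∘ assoc X Y X ∘ (coev ⊙₂ idm X)
      ∘ inv (lunit_iso X) = idm X;
  dual_triangle_r :
    lunit Y ∘ (ev ⊙₂ idm Y) ∘ inv (assoc_iso Y X Y) ∘ (idm Y ⊙₂ coev)
      ∘ inv (runit_iso Y) = idm Y
}.
Arguments coev {_ _ _ _ _} _.
Arguments ev {_ _ _ _ _} _.

(* [base] is the chosen 0-cell I.  The isomorphism <<X>> ≅ X on B(I,I) is part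
   of the structure, but it is not required to be natural in X. *)
Record Shadows (BB : Bicategory) := {
  base : BB;
  shadow : forall A : BB, Functor (cell1 A A) (cell1 base base);
  shadow_base : forall X : cell1 base base, hom (shadow base X) X;
  shadow_base_iso : forall X, IsIso (shadow_base X);
  theta : forall (A B : BB) (X : cell1 B A) (Y : cell1 A B),
    hom (shadow A (X ⊙ Y)) (shadow B (Y ⊙ X));
  theta_iso : forall (A B : BB) (X : cell1 B A) (Y : cell1 A B),
    IsIso (theta X Y);
  theta_nat : forall (A B : BB) (X X' : cell1 B A) (Y Y' : cell1 A B)
      (f : hom X X') (g : hom Y Y'),
    theta X' Y' ∘ fmap (shadow A) (f ⊙₂ g)
      = fmap (shadow B) (g ⊙₂ f) ∘ theta X Y;
  theta_cyclic : forall (A B C : BB)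
      (X : cell1 B A) (Y : cell1 C B) (Z : cell1 A C),
    fmap (shadow C) (assoc Z X Y) ∘ theta Y (Z ⊙ X)
        ∘ fmap (shadow B) (assoc Y Z X) ∘ theta X (Y ⊙ Z)
        ∘ fmap (shadow A) (assoc X Y Z)
      = theta (X ⊙ Y) Z;
  theta_unit_r : forall (A : BB) (Z : cell1 A A),
    fmap (shadow A) (lunit Z) ∘ theta Z (unit1 A)
      = fmap (shadow A) (runit Z);
  theta_unit_l : forall (A : BB) (Z : cell1 A A),
    fmap (shadow A) (runit Z) ∘ theta (unit1 A) Z
      = fmap (shadow A) (lunit Z)
}.
Arguments base {_} _.
Arguments shadow {_} _ _.
Arguments theta {_} _ {_ _} _ _.

Definition trace (BB : Bicategory) (S : Shadows BB) (A B : BB)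
    (X : cell1 B A) (Y : cell1 A B) (D : DualPair X Y)
    (Q : cell1 A A) (P : cell1 B B) (f : hom (Q ⊙ X) (X ⊙ P)) :
    hom (shadow S A Q) (shadow S B P) :=
  fmap (shadow S B) (lunit P)
  ∘ fmap (shadow S B) (ev D ⊙₂ idm P)
  ∘ fmap (shadow S B) (inv (assoc_iso Y X P))
  ∘ theta S (X ⊙ P) Y
  ∘ fmap (shadow S A) (f ⊙₂ idm Y)
  ∘ fmap (shadow S A) (inv (assoc_iso Q X Y))
  ∘ fmap (shadow S A) (idm Q ⊙₂ coev D)
  ∘ fmap (shadow S A) (inv (runit_iso Q)).
Arguments trace {_} _ {_ _ _ _} _ {_ _} _.

Record LaxFunctor (BB BB' : Bicategory) := {
  lax0 :> BB -> BB';
  lax1 : forall A B : BB, Functor (cell1 A B) (cell1 (lax0 A) (lax0 B));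
  phi : forall (A B C : BB) (X : cell1 B C) (Y : cell1 A B),
    hom (lax1 B C X ⊙ lax1 A B Y) (lax1 A C (X ⊙ Y));
  phi_nat : forall (A B C : BB) (X X' : cell1 B C) (Y Y' : cell1 A B)
      (f : hom X X') (g : hom Y Y'),
    phi X' Y' ∘ (fmap (lax1 B C) f ⊙₂ fmap (lax1 A B) g)
      = fmap (lax1 A C) (f ⊙₂ g) ∘ phi X Y;
  phi0 : forall A : BB, hom (unit1 (lax0 A)) (lax1 A A (unit1 A));
  phi_assoc : forall (A B C D : BB)
      (X : cell1 C D) (Y : cell1 B C) (Z : cell1 A B),
    fmap (lax1 A D) (assoc X Y Z) ∘ phi (X ⊙ Y) Z
        ∘ (phi X Y ⊙₂ idm (lax1 A B Z))
      = phi X (Y ⊙ Z) ∘ (idm (lax1 C D X) ⊙₂ phi Y Z)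
        ∘ assoc (lax1 C D X) (lax1 B C Y) (lax1 A B Z);
  phi_lunit : forall (A B : BB) (X : cell1 A B),
    fmap (lax1 A B) (lunit X) ∘ phi (unit1 B) X
        ∘ (phi0 B ⊙₂ idm (lax1 A B X))
      = lunit (lax1 A B X);
  phi_runit : forall (A B : BB) (X : cell1 A B),
    fmap (lax1 A B) (runit X) ∘ phi X (unit1 A)
        ∘ (idm (lax1 A B X) ⊙₂ phi0 A)
      = runit (lax1 A B X)
}.
Arguments lax1 {_ _} _ {_ _}.
Arguments phi {_ _} _ {_ _ _} _ _.
Arguments phi0 {_ _} _ _.

Lemma iso_inv_cancel (C : Category) (x y : C) (f : hom x y) (h : IsIso f)
    (g : hom x y) : g ∘ inv h = idm y -> g = f.
Proof.
  intros E.
  rewrite <- (comp_idr g), <- (inv_l h), comp_assoc, E; apply comp_idl.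
Qed.

Lemma odot2_comp_l (BB : Bicategory) (A B C : BB) (X X' X'' : cell1 B C)
    (Y : cell1 A B) (f' : hom X' X'') (f : hom X X') :
  (f' ∘ f) ⊙₂ idm Y = (f' ⊙₂ idm Y) ∘ (f ⊙₂ idm Y).
Proof. rewrite <- odot2_comp, comp_idl; reflexivity. Qed.

Lemma odot2_comp_r (BB : Bicategory) (A B C : BB) (X : cell1 B C)
    (Y Y' Y'' : cell1 A B) (g' : hom Y' Y'') (g : hom Y Y') :
  idm X ⊙₂ (g' ∘ g) = (idm X ⊙₂ g') ∘ (idm X ⊙₂ g).
Proof. rewrite <- odot2_comp, comp_idl; reflexivity. Qed.

Lemma phi_nat_l (BB BB' : Bicategory) (F : LaxFunctor BB BB') (A B C : BB)
    (X X' : cell1 B C) (Y : cell1 A B) (f : hom X X') :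
  phi F X' Y ∘ (fmap (lax1 F) f ⊙₂ idm (lax1 F Y))
    = fmap (lax1 F) (f ⊙₂ idm Y) ∘ phi F X Y.
Proof. rewrite <- phi_nat, fmap_id; reflexivity. Qed.

Lemma phi_nat_r (BB BB' : Bicategory) (F : LaxFunctor BB BB') (A B C : BB)
    (X : cell1 B C) (Y Y' : cell1 A B) (g : hom Y Y') :
  phi F X Y' ∘ (idm (lax1 F X) ⊙₂ fmap (lax1 F) g)
    = fmap (lax1 F) (idm X ⊙₂ g) ∘ phi F X Y.
Proof. rewrite <- phi_nat, fmap_id; reflexivity. Qed.

Definition lax_coev (BB BB' : Bicategory) (F : LaxFunctor BB BB') (A B : BB)
    (X : cell1 B A) (Y : cell1 A B) (D : DualPair X Y)
    (hXY : IsIso (phi F X Y)) : hom (unit1 (F A)) (lax1 F X ⊙ lax1 F Y) :=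
  inv hXY ∘ fmap (lax1 F) (coev D) ∘ phi0 F A.

Definition lax_ev (BB BB' : Bicategory) (F : LaxFunctor BB BB') (A B : BB)
    (X : cell1 B A) (Y : cell1 A B) (D : DualPair X Y)
    (hB : IsIso (phi0 F B)) : hom (lax1 F Y ⊙ lax1 F X) (unit1 (F B)) :=
  inv hB ∘ fmap (lax1 F) (ev D) ∘ phi F Y X.

Definition lax_dual_pair (BB BB' : Bicategory) (F : LaxFunctor BB BB')
    (A B : BB) (X : cell1 B A) (Y : cell1 A B) (D : DualPair X Y)
    (hXY : IsIso (phi F X Y)) (hB : IsIso (phi0 F B)) :
  DualPair (lax1 F X) (lax1 F Y).
Proof.
  refine {| coev := lax_coev D hXY; ev := lax_ev D hB |}.
  - assert (Er : runit (lax1 F X) ∘ (idm (lax1 F X) ⊙₂ inv hB)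
                 = fmap (lax1 F) (runit X) ∘ phi F X (unit1 B)).
    { rewrite <- (phi_runit F X), <- comp_assoc, <- odot2_comp_r, (inv_r hB),
        odot2_id; apply comp_idr. }
    assert (Ea : phi F X (Y ⊙ X) ∘ (idm (lax1 F X) ⊙₂ phi F Y X)
                   ∘ assoc _ _ _ ∘ (inv hXY ⊙₂ idm (lax1 F X))
                 = fmap (lax1 F) (assoc X Y X) ∘ phi F (X ⊙ Y) X).
    { rewrite <- (phi_assoc F X Y X), <- comp_assoc, <- odot2_comp_l,
        (inv_r hXY), odot2_id; apply comp_idr. }
    unfold lax_coev, lax_ev.
    rewrite !odot2_comp_l, !odot2_comp_r, !comp_assoc, Er.
    rewrite <- (comp_assoc _ (phi F X (unit1 B))), phi_nat_r.
    rewrite !comp_assoc, <- fmap_comp.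
    rewrite <- (comp_assoc _ (phi F X _)), <- (comp_assoc _ _ (assoc _ _ _)),
      <- (comp_assoc _ _ (inv hXY ⊙₂ _)), Ea.
    rewrite !comp_assoc, <- fmap_comp.
    rewrite <- (comp_assoc _ (phi F _ X)), phi_nat_l.
    rewrite !comp_assoc, <- fmap_comp.
    rewrite (iso_inv_cancel (dual_triangle_l D)), phi_lunit; apply inv_r.
  - assert (El : lunit (lax1 F Y) ∘ (inv hB ⊙₂ idm (lax1 F Y))
                 = fmap (lax1 F) (lunit Y) ∘ phi F (unit1 B) Y).
    { rewrite <- (phi_lunit F Y), <- comp_assoc, <- odot2_comp_l, (inv_r hB),
        odot2_id; apply comp_idr. }
    assert (Ea : phi F (Y ⊙ X) Y ∘ (phi F Y X ⊙₂ idm (lax1 F Y))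
                   ∘ inv (assoc_iso _ _ _) ∘ (idm (lax1 F Y) ⊙₂ inv hXY)
                 = fmap (lax1 F) (inv (assoc_iso Y X Y)) ∘ phi F Y (X ⊙ Y)).
    { rewrite <- (comp_idl (phi F (Y ⊙ X) Y)), <- fmap_id,
        <- (inv_l (assoc_iso Y X Y)), fmap_comp.
      rewrite <- !(comp_assoc (fmap (lax1 F) (inv (assoc_iso Y X Y)))).
      rewrite (phi_assoc F Y X Y).
      rewrite <- !comp_assoc, (comp_assoc _ _ (idm _ ⊙₂ inv hXY)),
        (inv_r (assoc_iso _ _ _)), comp_idl, <- odot2_comp_r, (inv_r hXY), odot2_id, comp_idr.
      reflexivity. }
    unfold lax_coev, lax_ev.
    rewrite !odot2_comp_l, !odot2_comp_r, !comp_assoc, El.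
    rewrite <- (comp_assoc _ (phi F (unit1 B) Y)), phi_nat_l.
    rewrite !comp_assoc, <- fmap_comp.
    rewrite <- (comp_assoc _ (phi F _ Y)),
      <- (comp_assoc _ _ (inv (assoc_iso _ _ _))),
      <- (comp_assoc _ _ (idm _ ⊙₂ inv hXY)), Ea.
    rewrite !comp_assoc, <- fmap_comp.
    rewrite <- (comp_assoc _ (phi F Y _)), phi_nat_r.
    rewrite !comp_assoc, <- fmap_comp.
    rewrite (iso_inv_cancel (dual_triangle_r D)), phi_runit; apply inv_r.
Defined.

Definition cast_end (BB : Bicategory) (A A' : BB) (e : A = A') :
  Functor (cell1 A A) (cell1 A' A') :=
  match e with eq_refl => idF (cell1 A A) end.

(* F takes the chosen 0-cell I of the source to the chosen 0-cell I' of the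
   target, F I = I', so that on B(I,I) it induces a functor with values in
   B'(I',I'), after transport along this equality. *)
Definition lax_base (BB BB' : Bicategory) (S : Shadows BB) (S' : Shadows BB')
    (F : LaxFunctor BB BB') (e : F (base S) = base S') :
  Functor (cell1 (base S) (base S)) (cell1 (base S') (base S')) :=
  compF (cast_end e) (@lax1 _ _ F (base S) (base S)).

Record ShadowCompatible (BB BB' : Bicategory)
    (S : Shadows BB) (S' : Shadows BB') (F : LaxFunctor BB BB') := {
  base_eq : F (base S) = base S';
  psi : forall (A : BB) (X : cell1 A A),
    hom (shadow S' (F A) (lax1 F X)) (lax_base base_eq (shadow S A X));
  psi_nat : forall (A : BB) (X X' : cell1 A A) (f : hom X X'),
    psi X' ∘ fmap (shadow S' (F A)) (fmap (lax1 F) f)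
      = fmap (lax_base base_eq) (fmap (shadow S A) f) ∘ psi X;
  psi_theta : forall (A B : BB) (X : cell1 B A) (Y : cell1 A B),
    psi (Y ⊙ X) ∘ fmap (shadow S' (F B)) (phi F Y X)
        ∘ theta S' (lax1 F X) (lax1 F Y)
      = fmap (lax_base base_eq) (theta S X Y) ∘ psi (X ⊙ Y)
        ∘ fmap (shadow S' (F A)) (phi F X Y)
}.
Arguments base_eq {_ _ _ _ _} _.
Arguments psi {_ _ _ _ _} _ {_} _.

Definition lax_twist (BB BB' : Bicategory) (F : LaxFunctor BB BB') (A B : BB)
    (X : cell1 B A) (Q : cell1 A A) (P : cell1 B B)
    (hXP : IsIso (phi F X P)) (f : hom (Q ⊙ X) (X ⊙ P)) :
    hom (lax1 F Q ⊙ lax1 F X) (lax1 F X ⊙ lax1 F P) :=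
  inv hXP ∘ fmap (lax1 F) f ∘ phi F Q X.

(* Main.v *)
(** Split the trace as <<r>> ∘ θ ∘ <<l>>, where
      [l : Q -> (X ⊙ P) ⊙ Y] and [r : Y ⊙ (X ⊙ P) -> P]
    come from the coevaluation and [f], resp. from the evaluation.  The lax
    structure carries the two halves of the trace of [lax_twist] to [F l] and
    [F r], at the cost of the comparison (FX ⊙ FP) ⊙ FY -> F((X ⊙ P) ⊙ Y) and
    its rotation; naturality of θ and compatibility of ψ with θ exchange these
    two comparisons. *)
Require Import Defs.

Set Implicit Arguments.
Unset Strict Implicit.

Definition trace_in (BB : Bicategory) (A B : BB)
    (X : cell1 B A) (Y : cell1 A B) (D : DualPair X Y)
    (Q : cell1 A A) (P : cell1 B B) (f : hom (Q ⊙ X) (X ⊙ P)) :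
    hom Q ((X ⊙ P) ⊙ Y) :=
  (f ⊙₂ idm Y) ∘ inv (assoc_iso Q X Y) ∘ (idm Q ⊙₂ coev D)
    ∘ inv (runit_iso Q).

Definition trace_out (BB : Bicategory) (A B : BB)
    (X : cell1 B A) (Y : cell1 A B) (D : DualPair X Y) (P : cell1 B B) :
    hom (Y ⊙ (X ⊙ P)) P :=
  lunit P ∘ (ev D ⊙₂ idm P) ∘ inv (assoc_iso Y X P).

Lemma trace_split (BB : Bicategory) (S : Shadows BB) (A B : BB)
    (X : cell1 B A) (Y : cell1 A B) (D : DualPair X Y)
    (Q : cell1 A A) (P : cell1 B B) (f : hom (Q ⊙ X) (X ⊙ P)) :
  trace S D f
    = fmap (shadow S B) (trace_out D P) ∘ theta S (X ⊙ P) Y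
        ∘ fmap (shadow S A) (trace_in D f).
Proof.
  unfold trace, trace_in, trace_out.
  rewrite !fmap_comp, !comp_assoc; reflexivity.
Qed.

Section LaxFunctor.
Variables (BB BB' : Bicategory) (F : LaxFunctor BB BB').

(** Inserting the identity $F(a^{-1})F(a)$ on the left, with $a$ the associator, exposes the
    coherence [phi_assoc]; the associator it leaves on the right cancels. *)
Lemma phi_assoc_inv (A B C D : BB)
    (X : cell1 C D) (Y : cell1 B C) (Z : cell1 A B) :
  phi F (X ⊙ Y) Z ∘ (phi F X Y ⊙₂ idm (lax1 F Z)) ∘ inv (assoc_iso _ _ _)
    = fmap (lax1 F) (inv (assoc_iso X Y Z)) ∘ phi F X (Y ⊙ Z)
        ∘ (idm (lax1 F X) ⊙₂ phi F Y Z).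
Proof.
  rewrite <- (comp_idl (phi F (X ⊙ Y) Z)), <- fmap_id,
    <- (inv_l (assoc_iso X Y Z)), fmap_comp.
  rewrite <- !(comp_assoc (fmap (lax1 F) (inv (assoc_iso X Y Z)))).
  rewrite phi_assoc, <- !comp_assoc, inv_r, comp_idr; reflexivity.
Qed.

Lemma phi_runit_inv (A B : BB) (X : cell1 A B) :
  phi F X (unit1 A) ∘ (idm (lax1 F X) ⊙₂ phi0 F A)
      ∘ inv (runit_iso (lax1 F X))
    = fmap (lax1 F) (inv (runit_iso X)).
Proof.
  rewrite <- (comp_idl (phi F X (unit1 A))), <- fmap_id,
    <- (inv_l (runit_iso X)), fmap_comp.
  rewrite <- !(comp_assoc (fmap (lax1 F) (inv (runit_iso X)))).
  rewrite phi_runit, inv_r, comp_idr; reflexivity.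
Qed.

Lemma lunit_phi0_inv (A B : BB) (hB : IsIso (phi0 F B)) (X : cell1 A B) :
  lunit (lax1 F X) ∘ (inv hB ⊙₂ idm (lax1 F X))
    = fmap (lax1 F) (lunit X) ∘ phi F (unit1 B) X.
Proof.
  rewrite <- (phi_lunit F X), <- comp_assoc, <- odot2_comp_l, inv_r, odot2_id.
  apply comp_idr.
Qed.

Variables (A B : BB) (X : cell1 B A) (Y : cell1 A B) (D : DualPair X Y).
Variables (hXY : IsIso (phi F X Y)) (hB : IsIso (phi0 F B)).
Variables (P : cell1 B B).

(** The comparison 2-cells travel from left to right: $\phi_{X,P}$ cancels the inverse in
    [lax_twist], the associator turns the remaining pair into one ending in $\phi_{X,Y}$, which
    cancels the inverse in [lax_coev], and the right unitor absorbs the last pair. *)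
Lemma lax_trace_in (Q : cell1 A A) (f : hom (Q ⊙ X) (X ⊙ P))
    (hXP : IsIso (phi F X P)) :
  phi F (X ⊙ P) Y ∘ (phi F X P ⊙₂ idm (lax1 F Y))
      ∘ trace_in (lax_dual_pair D hXY hB) (lax_twist hXP f)
    = fmap (lax1 F) (trace_in D f).
Proof.
  assert (Ef : phi F (X ⊙ P) Y ∘ (phi F X P ⊙₂ idm (lax1 F Y))
                   ∘ (lax_twist hXP f ⊙₂ idm (lax1 F Y))
               = fmap (lax1 F) (f ⊙₂ idm Y) ∘ phi F (Q ⊙ X) Y
                   ∘ (phi F Q X ⊙₂ idm (lax1 F Y))).
  { unfold lax_twist.
    rewrite <- comp_assoc, <- odot2_comp_l, !comp_assoc, inv_r, comp_idl.
    rewrite odot2_comp_l, comp_assoc, phi_nat_l; reflexivity. }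
  assert (Ec : phi F Q (X ⊙ Y) ∘ (idm (lax1 F Q) ⊙₂ phi F X Y)
                   ∘ (idm (lax1 F Q) ⊙₂ lax_coev D hXY)
               = fmap (lax1 F) (idm Q ⊙₂ coev D) ∘ phi F Q (unit1 A)
                   ∘ (idm (lax1 F Q) ⊙₂ phi0 F A)).
  { unfold lax_coev.
    rewrite <- comp_assoc, <- odot2_comp_r, !comp_assoc, inv_r, comp_idl.
    rewrite odot2_comp_r, comp_assoc, phi_nat_r; reflexivity. }
  unfold trace_in; cbn [coev lax_dual_pair].
  rewrite !comp_assoc, Ef.
  rewrite <- (comp_assoc (fmap _ _)), <- (comp_assoc (fmap _ _)), phi_assoc_inv.
  rewrite <- (comp_assoc (fmap _ (inv _))), comp_assoc, <- fmap_comp.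
  rewrite <- (comp_assoc (fmap _ _)), Ec.
  rewrite <- (comp_assoc (fmap _ (idm Q ⊙₂ _))), comp_assoc, <- fmap_comp.
  rewrite <- (comp_assoc (fmap _ _)), phi_runit_inv, <- fmap_comp.
  reflexivity.
Qed.

(** The left unitor absorbs the inverse of [phi0] in [lax_ev]; the factor $\phi_{Y,X}$ of [lax_ev]
    then crosses the associator and becomes the comparison on the right. *)
Lemma lax_trace_out :
  trace_out (lax_dual_pair D hXY hB) (lax1 F P)
    = fmap (lax1 F) (trace_out D P) ∘ phi F Y (X ⊙ P)
        ∘ (idm (lax1 F Y) ⊙₂ phi F X P).
Proof.
  unfold trace_out; cbn [ev lax_dual_pair]; unfold lax_ev.
  rewrite !odot2_comp_l, !comp_assoc, lunit_phi0_inv.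
  rewrite <- (comp_assoc _ (phi F (unit1 B) P)), phi_nat_l.
  rewrite comp_assoc, <- fmap_comp.
  rewrite <- (comp_assoc (fmap _ _)), <- (comp_assoc (fmap _ _)), phi_assoc_inv.
  rewrite !comp_assoc, <- fmap_comp; reflexivity.
Qed.

End LaxFunctor.

Theorem proposition4p5p7
  (BB BB' : Bicategory) (S : Shadows BB) (S' : Shadows BB')
  (F : LaxFunctor BB BB') (K : ShadowCompatible S S' F)
  (A B : BB) (X : cell1 B A) (Y : cell1 A B) (D : DualPair X Y)
  (hXY : IsIso (phi F X Y)) (hB : IsIso (phi0 F B))
  (Q : cell1 A A) (P : cell1 B B) (f : hom (Q ⊙ X) (X ⊙ P))
  (hXP : IsIso (phi F X P)) :
  psi K P ∘ trace S' (lax_dual_pair D hXY hB) (lax_twist hXP f)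
    = fmap (lax_base (base_eq K)) (trace S D f) ∘ psi K Q.
Proof.
  rewrite !trace_split, lax_trace_out, !fmap_comp.
  rewrite !comp_assoc, psi_nat.
  (* Naturality of θ carries $\phi_{X,P}$ from after the rotation to before it. *)
  rewrite <- (comp_assoc _ _ (theta S' _ _)), <- theta_nat.
  rewrite !comp_assoc.
  (* Compatibility of ψ with θ is applied to the pair [X ⊙ P], [Y], trading $\phi_{Y,X\odot P}$ for
     $\phi_{X\odot P,Y}$. *)
  rewrite <- (comp_assoc _ (psi K _)), <- (comp_assoc _ (_ ∘ _) (theta S' _ _)),
    psi_theta.
  (* Now the right-hand side: ψ moves past [trace_in], so that [lax_trace_in] can expand its image
     under $F$ into the 2-cells already on the left. *)
  rewrite <- (comp_assoc _ _ (psi K Q)), <- psi_nat.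
  rewrite <- (lax_trace_in D hXY hB f hXP), !fmap_comp, !comp_assoc.
  reflexivity.
Qed.
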